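(* Let $V$ be a finite set, $n=\#V$, $k\ge1$, $f:\mathcal P(V)^k\to\mathbb R$ and $g:\mathcal P(V)^k\to\mathbb R_+=(0,\infty)$, with piecewise multilinear extensions $f^M,g^M$. Write $f_\triangle(A)=f(A,\dots,A)$, $g_\triangle(A)=g(A,\dots,A)$, $f^M_\triangle(x)=f^M(x,\dots,x)$, $g^M_\triangle(x)=g^M(x,\dots,x)$. Then $$\max_{A\subset V}\frac{f_\triangle(A)}{g_\triangle(A)}\le\max_{x\in\mathbb R^n_{\ge0}}\frac{f^M_\triangle(x)}{g^M_\triangle(x)}\le\max_{\text{chain }\{A_1,\dots,A_k\}}\frac{f(A_1,\dots,A_k)}{g(A_1,\dots,A_k)}=\max_{\substack{x^1,\dots,x^k\in\mathbb R^n_{\ge0}\\ \text{pairwise comonotonic}}}\frac{f^M(x^1,\dots,x^k)}{g^M(x^1,\dots,x^k)}.$$ If all ''$\max$'' are replaced by ''$\min$'', the same holds with all ''$\le$'' replaced by ''$\ge$''. Here all sets $A,A_1,\dots,A_k\subset V$ are nonempty and all vectors $x,x^1,\dots,x^k$ are nonzero.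
   Context: Piecewise multilinear extension: for $h:\mathcal P(V)^k\to\mathbb R$ define $h^M:(\mathbb R^n)^k\to\mathbb R$ by $$h^M(x^1,\dots,x^k)=\sum_{i_1,\dots,i_k=0}^{n-1}\ \prod_{s=1}^k\big(x^s_{(i_s+1)}-x^s_{(i_s)}\big)\,h\big(V^{(i_1)}(x^1),\dots,V^{(i_k)}(x^k)\big),$$ where $x^s_{(1)}\le\dots\le x^s_{(n)}$ is the non-decreasing rearrangement of the entries of $x^s$, $x^s_{(0)}:=0$, $V^{(0)}(x^s):=V$, $V^{(i)}(x^s):=\{j\in V:x^s_j>x^s_{(i)}\}$ for $i\ge1$. ''Chain'' means that $A_1,\dots,A_k$ form an inclusion chain in some order: $A_{\sigma(1)}\subset\dots\subset A_{\sigma(k)}$ for some permutation $\sigma$. Vectors $x,y\in\mathbb R^n$ are comonotonic if $(x_i-x_j)(y_i-y_j)\ge0$ for all $i,j\in V$. *)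

(* Defs.v *)
From mathcomp Require Import all_boot all_order all_fingroup all_algebra.
From mathcomp Require Import reals.

Set Implicit Arguments.
Unset Strict Implicit.
Unset Printing Implicit Defensive.

Import Order.TTheory GRing.Theory Num.Theory.
Local Open Scope ring_scope.

Section Defs.
Variables (R : realType) (V : finType) (k : nat).

(* x_(i), with x_(0) = 0. The default value of nth is never read for i <= #|V|. *)
Definition ordstat (x : {ffun V -> R}) (i : nat) : R :=
  (0 :: sort <=%R (codom x))`_i.

(* V^(i)(x) *)
Definition upper_set (x : {ffun V -> R}) (i : nat) : {set V} :=
  if i == 0%N then [set: V] else [set j | ordstat x i < x j].

(* h^M; the k-fold sum over i_1, ..., i_k in {0, ..., n - 1} is one sum over
   the functions i. *)
Definition pm_ext (h : {ffun 'I_k -> {set V}} -> R)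
    (x : {ffun 'I_k -> {ffun V -> R}}) : R :=
  \sum_(i : {ffun 'I_k -> 'I_#|V|})
    (\prod_(s < k) (ordstat (x s) (i s).+1 - ordstat (x s) (i s)))
      * h [ffun s => upper_set (x s) (i s)].

Definition diag (T : Type) (a : T) : {ffun 'I_k -> T} := [ffun => a].

Definition is_chain (A : {ffun 'I_k -> {set V}}) : Prop :=
  exists sigma : 'S_k,
    sorted (fun B C : {set V} => B \subset C) [seq A (sigma s) | s : 'I_k].

Definition comonotonic (x y : {ffun V -> R}) : Prop :=
  forall i j : V, 0 <= (x i - x j) * (y i - y j).

(* Nonzero elements of the closed nonnegative orthant. *)
Definition nonneg_nonzero (x : {ffun V -> R}) : Prop :=
  (forall j, 0 <= x j) /\ x != 0.

(* m is the maximum (resp. minimum), attained, of F over the elements of T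
   satisfying P. *)
Definition is_max_on (T : Type) (P : T -> Prop) (F : T -> R) (m : R) : Prop :=
  (exists2 a, P a & F a = m) /\ (forall a, P a -> F a <= m).

Definition is_min_on (T : Type) (P : T -> Prop) (F : T -> R) (m : R) : Prop :=
  (exists2 a, P a & F a = m) /\ (forall a, P a -> m <= F a).

Definition nonempty_chain (A : {ffun 'I_k -> {set V}}) : Prop :=
  (forall s, A s != set0) /\ is_chain A.

Definition comonotonic_family (x : {ffun 'I_k -> {ffun V -> R}}) : Prop :=
  (forall s, nonneg_nonzero (x s)) /\ (forall s t, comonotonic (x s) (x t)).

End Defs.

Arguments diag {k T} a.

(* Main.v *)
Require Import Defs.
From mathcomp Require Import all_boot all_order all_fingroup all_algebra.
From mathcomp Require Import reals.
From mathcomp Require boolp classical_sets topology normedtype derive.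

Import Order.TTheory GRing.Theory Num.Theory.
Local Open Scope ring_scope.

(** Let p list V so that every vector x^s is nondecreasing along p. Wherever the
    increment x^s_(i+1) - x^s_(i) is nonzero, the upper set V^(i)(x^s) is the
    set of the elements of p from position i on; where the increment is zero,
    the term vanishes whatever the set is. Hence ([pm_ext_sorts]) f^M(x) is a
    multilinear form in the increments, whose coefficients are values of f at
    tails of p. For nonnegative nonzero vectors the increments are nonnegative
    and not all zero.

    A pairwise comonotonic family has one enumeration p common to all its
    vectors, namely one that sorts their sum ([comonotonic_sorts]). The sets at
    which f and g are then evaluated are tails of the same list, so they form a
    nonempty chain, and f(A) <= m g(A) on chains gives f^M(x) <= m g^M(x) on
    summing with nonnegative weights ([pm_ext_ratio_le]). Conversely f^M takes
    the value f(A) at the indicators of A_1, ..., A_k ([pm_ext_indicator]), and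
    the indicators of a chain are comonotonic; so the last two maxima agree. The
    first maximum is at most the second by evaluating at indicators, and the
    second is at most the last because constant families are comonotonic.

    It remains that the second maximum, over a noncompact set, is attained
    ([pm_ext_diag_ratio_max]). For a fixed enumeration the ratio is a quotient
    of two homogeneous forms of the same degree in the increments, so it can be
    maximised on the standard simplex, which is compact; there are finitely many
    enumerations. The minima of the ratios are the opposites of the maxima for -f. *)

(** * Multilinear forms with nonnegative arguments *)

Definition multilinear_form {R : pzRingType} {n k : nat}
    (a : {ffun 'I_k -> 'I_n} -> R) (t : 'I_k -> 'I_n -> R) : R :=
  \sum_(i : {ffun 'I_k -> 'I_n}) (\prod_(s < k) t s (i s)) * a i.

Section MultilinearForm.
Context {R : realType} {n k : nat}.
Implicit Types (a b : {ffun 'I_k -> 'I_n} -> R) (t : 'I_k -> 'I_n -> R).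

Lemma multilinear_form_gt0 a t : (forall i, 0 < a i) ->
    (forall s j, 0 <= t s j) -> (forall s, exists j, 0 < t s j) ->
  0 < multilinear_form a t.
Proof.
move=> a_gt0 t_ge0 /fin_all_exists[j tj_gt0].
rewrite /multilinear_form (bigD1 [ffun s => j s]) //= ltr_wpDr //.
  by apply: sumr_ge0 => i _; rewrite mulr_ge0 ?prodr_ge0 // ltW.
by rewrite mulr_gt0 // prodr_gt0 // => s _; rewrite ffunE.
Qed.

Lemma multilinear_form_le a b t m : (forall s j, 0 <= t s j) ->
    (forall i, a i <= m * b i) ->
  multilinear_form a t <= m * multilinear_form b t.
Proof.
move=> t_ge0 ab; rewrite /multilinear_form mulr_sumr.
apply: ler_sum => i _; rewrite mulrCA ler_wpM2l //.
by apply: prodr_ge0.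
Qed.

Lemma multilinear_form_scale a (t : 'I_n -> R) c :
  multilinear_form a (fun _ j => c * t j)
    = c ^+ k * multilinear_form a (fun=> t).
Proof.
rewrite /multilinear_form mulr_sumr; apply: eq_bigr => i _.
by rewrite big_split /= prodr_const card_ord mulrA.
Qed.

Lemma multilinear_form_unit a (i : {ffun 'I_k -> 'I_n}) :
  multilinear_form a (fun s j => (j == i s)%:R) = a i.
Proof.
rewrite /multilinear_form (bigD1 i) //= big1 => [|s _]; last by rewrite eqxx.
rewrite mul1r big1 ?addr0 // => i' neq_i'i.
have [s neq_s] : exists s, i' s != i s.
  apply/existsP; apply: contraNT neq_i'i; rewrite negb_exists => /forallP eq_i.
  by apply/eqP/ffunP => s; apply/eqP; have := eq_i s; rewrite negbK.
by rewrite (bigD1 s) //= (negPf neq_s) !mul0r.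
Qed.

End MultilinearForm.

(** * Ratios of forms on the simplex *)

Module Simplex.

Import boolp classical_sets topology normedtype derive.
Import numFieldNormedType.Exports numFieldTopology.Exports.
Local Open Scope classical_set_scope.

Definition simplex (R : realType) (n : nat) : set 'rV[R]_n :=
  [set v | forall j, `[0, 1]%classic (v ord0 j)]
    `&` [set v | \sum_j v ord0 j = 1].

Lemma simplex_compact (R : realType) n : compact (simplex R n).
Proof.
apply: compact_closedI.
  apply: (@rV_compact R n (fun=> `[0, 1]%classic)) => _; exact: segment_compact.
apply: (@preimage_closed _ _ (fun v : 'rV[R]_n => \sum_j v ord0 j)
  [set y | y = 1]).
  move=> v _; move: v; apply: continuous_big; first exact: add_continuous.
  by move=> i _; apply: coord_continuous.
exact: closed_eq.
Qed.

Lemma multilinear_form_continuous (R : realType) n k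
    (a : {ffun 'I_k -> 'I_n} -> R) :
  continuous (fun v : 'rV[R]_n => multilinear_form a (fun=> v ord0)).
Proof.
apply: continuous_big => [|i _]; first exact: add_continuous.
have prodc : continuous (fun v : 'rV[R]_n => \prod_(s < k) v ord0 (i s)).
  apply: continuous_big => [|s _]; first exact: mul_continuous.
  exact: coord_continuous.
move=> v.
exact: (@continuousM R _ _ (fun=> a i) v (prodc v)
  (@cst_continuous _ _ (a i) v)).
Qed.

(** On the diagonal both forms are homogeneous of degree k, so their ratio takes
    on the simplex every value that it takes on the closed nonnegative orthant
    minus the origin. The denominator does not vanish on the simplex, and a
    continuous function attains its maximum on a compact set. *)
Lemma multilinear_form_ratio_max (R : realType) n k
    (a b : {ffun 'I_k -> 'I_n} -> R) :
    (0 < n)%N -> (forall i, 0 < b i) ->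
  exists c : 'I_n -> R, [/\ forall j, 0 <= c j, exists j, 0 < c j &
    forall t : 'I_n -> R, (forall j, 0 <= t j) -> (exists j, 0 < t j) ->
    multilinear_form a (fun=> t) / multilinear_form b (fun=> t)
    <= multilinear_form a (fun=> c) / multilinear_form b (fun=> c)].
Proof.
move=> n_gt0 b_gt0.
have simplex_pos v : simplex R n v -> exists j, 0 < v ord0 j.
  move=> [v01 v1]; apply/existsP; apply: contra_eqT v1.
  rewrite negb_exists => /forallP v_le0.
  rewrite lt_eqF // (le_lt_trans _ ltr01) // sumr_le0 // => j _.
  by rewrite leNgt.
have simplex_ge0 v j : simplex R n v -> 0 <= v ord0 j.
  by move=> [/(_ j)/= + _]; rewrite in_itv /= => /andP[].
pose ratio (v : 'rV[R]_n) :=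
  multilinear_form a (fun=> v ord0) / multilinear_form b (fun=> v ord0).
have [||c] := @EVT_max_rV R n ratio (simplex R n) _ (@simplex_compact R n).
- exists (delta_mx ord0 (Ordinal n_gt0)); split => [j|] /=.
    by rewrite mxE in_itv /= ler0n lern1 leq_b1.
  rewrite (bigD1 (Ordinal n_gt0)) //= mxE !eqxx big1 ?addr0 // => j neq_j.
  by rewrite mxE (negPf neq_j) andbF.
- apply: continuous_in_subspaceT => v /[!inE] v_simplex.
  have b_neq0 : multilinear_form b (fun=> v ord0) != 0.
    rewrite gt_eqF // multilinear_form_gt0 // => s; last exact: simplex_pos.
    by move=> j; exact: simplex_ge0.
  apply: (@continuousM R _ _ _ v (multilinear_form_continuous _ _ _ a v)).
  exact: (continuousV b_neq0 (multilinear_form_continuous _ _ _ b v)).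
rewrite inE => c_simplex max_c; exists (c ord0); split.
- by move=> j; exact: simplex_ge0.
- exact: simplex_pos.
move=> t t_ge0 [j tj_gt0].
(* The maximality of c is applied to t rescaled into the simplex. *)
have S_gt0 : 0 < \sum_j t j.
  by rewrite (bigD1 j) //= ltr_wpDr // sumr_ge0.
set S := \sum_j t j in S_gt0.
pose v : 'rV[R]_n := \row_j (t j / S).
have tE (h : {ffun 'I_k -> 'I_n} -> R) : multilinear_form h (fun=> t)
    = S ^+ k * multilinear_form h (fun=> v ord0).
  rewrite -(multilinear_form_scale (k := k) h (v ord0) S).
  congr multilinear_form.
  by apply/funext => s; apply/funext => i; rewrite mxE mulrC divfK ?gt_eqF.
rewrite !tE invfM mulrACA divff ?mul1r; last by rewrite expf_neq0 ?gt_eqF.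
apply: (max_c v); rewrite inE; split => [i|] /=; last first.
  by under eq_bigr do rewrite mxE; rewrite -mulr_suml divff ?gt_eqF.
rewrite mxE in_itv /= divr_ge0 ?(ltW S_gt0) // ler_pdivrMr // mul1r /S.
by rewrite (bigD1 i) //= lerDl sumr_ge0.
Qed.

End Simplex.

(** * Enumerations that sort a vector *)

Section SortingEnumerations.
Context {R : realType} {V : finType}.
Implicit Types (x : {ffun V -> R}) (p : seq V).

(** A permutation witnessing the nondecreasing rearrangement of x; ties may be
    broken in any way, which lets several vectors share an enumeration. *)
Definition sorts x p : bool :=
  perm_eq p (enum V) && sorted <=%R (map x p).

Definition tail_set p (i : nat) : {set V} := [set v in drop i p].

Definition increment x (i : nat) : R := ordstat x i.+1 - ordstat x i.

Lemma ordstat_sorts x p i : sorts x p -> ordstat x i = (0 :: map x p)`_i.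
Proof.
move=> /andP[p_enum x_sorted]; rewrite /ordstat.
suff -> : sort <=%R (codom x) = map x p by [].
apply: (sorted_eq le_trans le_anti) => //; first exact: sort_le_sorted.
by rewrite perm_sort codomE perm_map // perm_sym.
Qed.

Lemma mem_drop_uniq (p : seq V) v i : uniq p -> v \in p ->
  (v \in drop i p) = (i <= index v p)%N.
Proof.
rewrite -{1 2}(cat_take_drop i p) mem_cat cat_uniq.
move=> /and3P[_ /hasPn disj _] v_p.
have v_in : v \in p by rewrite -(cat_take_drop i p) mem_cat.
rewrite leqNgt -in_take //.
by apply/idP/idP => [/disj//|/negPf vN]; move: v_p; rewrite vN.
Qed.

(** As x_(i) and x_(i+1) are consecutive sorted values and differ, an entry
    exceeds x_(i) exactly when it is at least x_(i+1), the value at position i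
    of p counted from 0. For i = 0 both sets are the whole of V. *)
Lemma upper_set_sorts x p i : sorts x p -> (i < #|V|)%N ->
  increment x i != 0 -> upper_set x i = tail_set p i.
Proof.
move=> xp lt_iV; have /andP[p_enum x_sorted] := xp.
have size_p : size p = #|V| by rewrite (perm_size p_enum) cardE.
have mem_p v : v \in p by rewrite (perm_mem p_enum) mem_enum.
have uniq_p : uniq p by rewrite (perm_uniq p_enum) enum_uniq.
rewrite /upper_set /increment subr_eq0 => jump.
case: i lt_iV jump => [|i] lt_iV jump.
  by apply/setP => v; rewrite !inE drop0 mem_p.
have x_nth v : x v = (map x p)`_(index v p).
  by rewrite (nth_map v) ?nth_index ?index_mem.
have x_mono a b : (a <= b < #|V|)%N -> (map x p)`_a <= (map x p)`_b.
  move=> /andP[le_ab lt_b]; apply: (sorted_leq_nth le_trans le_refl) => //.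
    by rewrite inE size_map size_p (leq_ltn_trans le_ab).
  by rewrite inE size_map size_p.
apply/setP => v; rewrite !inE /= (ordstat_sorts _ _ _ xp) /=.
rewrite mem_drop_uniq // x_nth.
case: (ltnP i (index v p)) => [lt_i|le_i]; last first.
  by apply/negbTE; rewrite -leNgt x_mono // le_i ltnW.
have : (map x p)`_i < (map x p)`_i.+1.
  rewrite lt_neqAle x_mono ?leqnSn // andbT eq_sym.
  by move: jump; rewrite !(ordstat_sorts _ _ _ xp).
move=> /lt_le_trans -> //; apply: x_mono; rewrite lt_i /=.
by rewrite -size_p index_mem.
Qed.

Lemma sorts_sort x : sorts x (sort (relpre x <=%R) (enum V)).
Proof.
rewrite /sorts perm_sort perm_refl sorted_map sort_sorted // => u v.
exact: le_total.
Qed.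

Lemma increment_ge0 x i : (forall v, 0 <= x v) -> (i < #|V|)%N ->
  0 <= increment x i.
Proof.
move=> x_ge0 lt_iV; rewrite subr_ge0 !(ordstat_sorts _ _ _ (sorts_sort x)).
have /andP[p_enum x_sorted] := sorts_sort x.
set p := sort _ _ in p_enum x_sorted *.
have size_p : size p = #|V| by rewrite (perm_size p_enum) cardE.
have : sorted <=%R (0 :: map x p).
  rewrite /= path_sortedE ?x_sorted ?andbT; last exact: le_trans.
  by apply/allP => _ /mapP[v _ ->].
move/(sorted_leq_nth le_trans le_refl); apply => //.
  by rewrite inE /= size_map size_p ltnW.
by rewrite inE /= size_map size_p.
Qed.

(** The increments telescope to the largest entry of x, since x_(0) = 0. *)
Lemma increment_gt0 x : nonneg_nonzero x ->
  exists i : 'I_#|V|, 0 < increment x i.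
Proof.
move=> [x_ge0 x_neq0]; apply/existsP; apply: contra_neqT x_neq0.
rewrite negb_exists => /forallP inc_le0.
have ord_le0 i : (i <= #|V|)%N -> ordstat x i <= 0.
  elim: i => [|i IHi] lt_iV; first by rewrite /ordstat.
  apply: le_trans (IHi (ltnW lt_iV)).
  by rewrite -subr_le0 leNgt (inc_le0 (Ordinal lt_iV)).
apply/ffunP => v; rewrite ffunE; apply/le_anti; rewrite x_ge0 andbT.
have xp := sorts_sort x; have /andP[p_enum _] := xp.
set p := sort _ _ in p_enum xp.
have v_p : v \in p by rewrite (perm_mem p_enum) mem_enum.
have := ord_le0 (index v p).+1; rewrite (ordstat_sorts _ _ _ xp) /=.
rewrite (nth_map v) ?index_mem // nth_index //; apply.
by rewrite cardE -(perm_size p_enum) index_mem.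
Qed.

Lemma ordstat0 i : ordstat (0 : {ffun V -> R}) i = 0.
Proof.
rewrite /ordstat; case: i => //= i.
have [lt_i|le_i] := ltnP i (size (sort <=%R (codom (0 : {ffun V -> R})))).
  by have := mem_nth 0 lt_i; rewrite mem_sort => /codomP[v ->]; rewrite ffunE.
exact: nth_default.
Qed.

(** The entry of x at v is the sum of the t j over the positions j up to that
    of v; so every nonnegative vector of increments occurs along any p. *)
Lemma sorts_with_increments (p : #|V|.-tuple V) (t : 'I_#|V| -> R) :
    perm_eq p (enum V) -> (forall j, 0 <= t j) ->
  exists2 x, sorts x p /\ (forall v, 0 <= x v) &
    forall j : 'I_#|V|, increment x j = t j.
Proof.
move=> p_enum t_ge0.
have uniq_p : uniq p by rewrite (perm_uniq p_enum) enum_uniq.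
pose x : {ffun V -> R} := [ffun v => \sum_(j < #|V| | (j <= index v p)%N) t j].
have x_nth i : (i < #|V|)%N -> (map x p)`_i = \sum_(j < #|V| | (j <= i)%N) t j.
  move=> lt_iV; have v := tnth p (Ordinal lt_iV).
  by rewrite (nth_map v) ?size_tuple // ffunE index_uniq ?size_tuple.
have xp : sorts x p.
  rewrite /sorts p_enum; apply/(sortedP 0) => i.
  rewrite size_map size_tuple => lt_iV; rewrite !x_nth ?(ltnW lt_iV) //.
  rewrite [leRHS](bigID (fun j : 'I__ => (j <= i)%N)) /=.
  rewrite [X in _ <= X + _](eq_bigl (fun j : 'I__ => (j <= i)%N)).
    by rewrite lerDl sumr_ge0.
  by move=> j; apply: andb_idl => le_ji; rewrite leqW.
exists x; first by split=> // v; rewrite ffunE sumr_ge0.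
have ordstatE i : (i <= #|V|)%N ->
    ordstat x i = \sum_(j < #|V| | (j < i)%N) t j.
  by case: i => [_|i /x_nth]; rewrite (ordstat_sorts _ _ _ xp) //= big_pred0.
move=> i; rewrite /increment !ordstatE ?(ltnW (ltn_ord i)) // (bigD1 i) //=.
rewrite [X in _ + X - _](eq_bigl (fun j : 'I__ => (j < i)%N)) ?addrK // => j.
by rewrite ltnS ltn_neqAle andbC.
Qed.

End SortingEnumerations.

(** * Indicators *)

Section Indicator.
Context {R : realType} {V : finType}.
Implicit Types A : {set V}.

Definition indicator A : {ffun V -> R} := [ffun v => (v \in A)%:R].

Lemma indicator_nonneg_nonzero A : A != set0 -> nonneg_nonzero (indicator A).
Proof.
move=> /set0Pn[v vA]; split => [u|]; first by rewrite ffunE ler0n.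
by apply/eqP => /ffunP/(_ v)/eqP; rewrite !ffunE vA oner_eq0.
Qed.

(** The indicator of A is 0 along the first part of this list and 1 along the
    second, so it has a single unit increment, and the tail there is A. *)
Definition indicator_enum A : seq V := enum (~: A) ++ enum A.

Lemma map_indicator_enum A :
  map (indicator A) (indicator_enum A) = nseq #|~: A| 0 ++ nseq #|A| 1.
Proof.
rewrite map_cat; congr (_ ++ _).
  rewrite cardE -(size_map (indicator A)).
  apply/all_pred1P/allP => _ /mapP[v + ->].
  by rewrite mem_enum inE /= ffunE => /negPf->.
rewrite cardE -(size_map (indicator A)).
apply/all_pred1P/allP => _ /mapP[v + ->].
by rewrite mem_enum /= ffunE => ->.
Qed.

Lemma indicator_sorts A : sorts (indicator A) (indicator_enum A).
Proof.
apply/andP; split.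
  apply: uniq_perm; rewrite ?enum_uniq //.
    rewrite cat_uniq !enum_uniq andbT /=; apply/hasPn => v.
    by rewrite !mem_enum inE negbK.
  by move=> v; rewrite mem_cat !mem_enum !inE orNb.
rewrite map_indicator_enum; elim: #|~: A| => [|m IHm] /=.
  by case: #|A| => //= m; elim: m => //= m ->; rewrite lexx.
rewrite path_sortedE ?IHm ?andbT; last exact: le_trans.
by rewrite all_cat !all_nseq lexx ler01 !orbT.
Qed.

Lemma increment_indicator A (i : 'I_#|V|) :
  increment (indicator A) i = (i == #|~: A| :> nat)%:R.
Proof.
have ordstatE j : (j <= #|V|)%N -> ordstat (indicator A) j = (#|~: A| < j)%:R.
  move=> le_jV; rewrite (ordstat_sorts _ _ _ (indicator_sorts A)).
  rewrite map_indicator_enum -[_ :: _]/(nseq #|~: A|.+1 0 ++ nseq #|A| 1).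
  rewrite nth_cat size_nseq ltnS !nth_nseq.
  case: (leqP j #|~: A|) => [le_j|lt_j]; first by rewrite ltnS le_j.
  by rewrite ltn_subLR // addSn ltnS addnC cardsC le_jV.
rewrite /increment !ordstatE ?(ltnW (ltn_ord i)) // ltnS.
rewrite [(i == _ :> nat)]eqn_leq leqNgt.
by case: ltngtP; rewrite ?subr0 ?subrr.
Qed.

Lemma tail_set_indicator A : tail_set (indicator_enum A) #|~: A| = A.
Proof.
rewrite /tail_set cardE drop_size_cat //.
by apply/setP => v; rewrite inE mem_enum.
Qed.

End Indicator.

(** * Chains and comonotonic families *)

Section Chains.
Context {R : realType} {V : finType} {k : nat}.

(** If one vector of the family is strictly larger at u than at v, the others
    are at least as large at u, so the sum y of the family is strictly larger
    too; an enumeration that sorts y therefore sorts every vector. *)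
Lemma comonotonic_sorts (x : {ffun 'I_k -> {ffun V -> R}}) :
  (forall s t, comonotonic (x s) (x t)) -> exists p, forall s, sorts (x s) p.
Proof.
move=> x_com; pose y : {ffun V -> R} := [ffun v => \sum_s x s v].
exists (sort (relpre y <=%R) (enum V)) => s.
have /andP[p_enum y_sorted] := sorts_sort y.
rewrite /sorts p_enum /= sorted_map.
move: y_sorted; rewrite sorted_map; apply: sub_sorted => u v /=.
rewrite !ffunE; apply: contraLR; rewrite -!ltNge => lt_vu.
have le_vu t : x t v <= x t u.
  by have := x_com s t u v; rewrite pmulr_rge0 ?subr_gt0 // subr_ge0.
rewrite (bigD1 s) //= [ltRHS](bigD1 s) //=; apply: ltr_leD => //.
exact: ler_sum.
Qed.

Lemma is_chainP (A : {ffun 'I_k -> {set V}}) :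
  is_chain A <-> forall s t, (A s \subset A t) || (A t \subset A s).
Proof.
split=> [[sigma] A_sorted s t|A_total].
  have sub_trans : transitive (fun B C : {set V} => B \subset C).
    by move=> C B D; exact: subset_trans.
  have A_mono (i j : 'I_k) : (i <= j)%N -> A (sigma i) \subset A (sigma j).
    have nthA (l : 'I_k) :
        nth set0 [seq A (sigma s) | s : 'I_k] l = A (sigma l).
      by rewrite (nth_map l) ?nth_ord_enum // size_enum_ord.
    rewrite -!nthA; apply: (sorted_leq_nth sub_trans) => //;
    by rewrite inE size_map size_enum_ord.
  rewrite -(permKV sigma s) -(permKV sigma t).
  have [/A_mono->//|/ltnW/A_mono->] := leqP (sigma^-1 s)%g (sigma^-1 t)%g.
  exact: orbT.
pose S := sort (fun s t => A s \subset A t) (enum 'I_k).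
have S_sorted : sorted (fun s t => A s \subset A t) S by exact: sort_sorted.
have /tuple_permP[sigma S_sigma] : perm_eq S (ord_tuple k).
  by rewrite val_ord_tuple perm_sort.
have map_sigma : [seq A (sigma s) | s : 'I_k] = map A S.
  rewrite S_sigma /= -map_comp.
  by apply: eq_map => s /=; rewrite tnth_ord_tuple.
by exists sigma; rewrite map_sigma sorted_map.
Qed.

Lemma tail_sets_nonempty_chain p (i : {ffun 'I_k -> 'I_#|V|}) :
    perm_eq p (enum V) ->
  nonempty_chain [ffun s => tail_set p (i s)].
Proof.
move=> p_enum; split=> [s|].
  rewrite ffunE /tail_set.
  have : (0 < size (drop (i s) p))%N.
    by rewrite size_drop subn_gt0 (perm_size p_enum) -cardE.
  case: (drop (i s) p) => // v q _.
  by apply/set0Pn; exists v; rewrite !inE eqxx.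
have tail_anti (a b : nat) : (a <= b)%N -> tail_set p b \subset tail_set p a.
  move=> le_ab; apply/subsetP => v; rewrite !inE -(subnK le_ab) -drop_drop.
  exact: mem_drop.
apply/is_chainP => s t; rewrite !ffunE.
by have [/tail_anti->|/ltnW/tail_anti->] := leqP (i s) (i t); rewrite ?orbT.
Qed.

Lemma diag_comonotonic_family (x : {ffun V -> R}) :
  nonneg_nonzero x -> comonotonic_family (@diag k _ x).
Proof.
move=> x_pos; split=> [s|s t i j]; rewrite !ffunE //.
by rewrite -expr2 sqr_ge0.
Qed.

Lemma indicator_comonotonic_family (A : {ffun 'I_k -> {set V}}) :
    nonempty_chain A ->
  comonotonic_family [ffun s => indicator (R := R) (A s)].
Proof.
move=> [A_neq0 /is_chainP A_chain]; split=> [s|s t i j].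
  by rewrite ffunE; exact: indicator_nonneg_nonzero.
rewrite !ffunE; wlog sub_st : s t / A s \subset A t.
  by case/orP: (A_chain s t) => /[swap]/[apply]//; rewrite mulrC.
have subA := subsetP sub_st.
have [/subA->|_] := boolP (i \in A s); have [/subA->|_] := boolP (j \in A s);
  rewrite ?subrr ?subr0 ?sub0r ?mul0r ?mulr0 //.
  by rewrite mul1r subr_ge0 lern1 leq_b1.
by rewrite mulN1r oppr_ge0 subr_le0 lern1 leq_b1.
Qed.

End Chains.

(** * The extension as a multilinear form *)

Section Extension.
Context {R : realType} {V : finType} {k : nat}.
Implicit Types (h : {ffun 'I_k -> {set V}} -> R).

(** A term in which some upper set differs from the tail of the enumeration has
    a zero increment as a factor, and drops out of both sums. *)
Lemma pm_ext_sorts h (x : {ffun 'I_k -> {ffun V -> R}}) (p : 'I_k -> seq V) :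
    (forall s, sorts (x s) (p s)) ->
  pm_ext h x =
    multilinear_form
      (fun i : {ffun 'I_k -> 'I_#|V|} => h [ffun s => tail_set (p s) (i s)])
      (fun s j => increment (x s) j).
Proof.
move=> xp; rewrite -[LHS]/(multilinear_form
  (fun i : {ffun 'I_k -> 'I_#|V|} => h [ffun s => upper_set (x s) (i s)])
  (fun s j => increment (x s) j)).
apply: eq_bigr => i _.
have [/eqP/prodf_eq0[s _ /eqP s0]|/prodf_neq0 nz] :=
    eqVneq (\prod_(s < k) increment (x s) (i s)) 0.
  by rewrite (bigD1 s) //= s0 !mul0r.
congr (_ * h _); apply/ffunP => s; rewrite !ffunE.
exact: upper_set_sorts (nz s isT).
Qed.

(** Nonemptiness matters: the empty set would need the index #|V|, which lies
    outside the range of summation. *)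
Lemma pm_ext_indicator h (A : {ffun 'I_k -> {set V}}) :
    (forall s, A s != set0) ->
  pm_ext h [ffun s => indicator (A s)] = h A.
Proof.
move=> A_neq0.
rewrite (@pm_ext_sorts _ _ (fun s => indicator_enum (A s))); last first.
  by move=> s; rewrite ffunE; exact: indicator_sorts.
have lt_cardC s : (#|~: A s| < #|V|)%N.
  by rewrite -(cardsC (A s)) -subn_gt0 addnK card_gt0.
pose i := [ffun s => Ordinal (lt_cardC s)].
have -> : (fun s (j : 'I_#|V|) =>
    increment ([ffun s => indicator (A s)] s) j : R)
    = fun s j => (j == i s)%:R.
  apply/boolp.funext => s; apply/boolp.funext => j.
  by rewrite !ffunE increment_indicator.
rewrite multilinear_form_unit; congr h; apply/ffunP => s.
by rewrite !ffunE tail_set_indicator.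
Qed.

Lemma pm_ext_gt0 h (x : {ffun 'I_k -> {ffun V -> R}}) : (forall A, 0 < h A) ->
  (forall s, nonneg_nonzero (x s)) -> 0 < pm_ext h x.
Proof.
move=> h_gt0 x_pos; rewrite (pm_ext_sorts h x _ (fun s => sorts_sort (x s))).
apply: multilinear_form_gt0 => [//|s j|s]; last exact: increment_gt0.
by apply: increment_ge0 => // v; case: (x_pos s).
Qed.

Lemma pm_extN h x : pm_ext (fun A => - h A) x = - pm_ext h x.
Proof. by rewrite /pm_ext -sumrN; apply: eq_bigr => i _; rewrite mulrN. Qed.

End Extension.

(** * Comparison of the maxima *)

Lemma fin_max_exists (R : realType) (T : finType) (P : T -> Prop) (F : T -> R) :
  (exists a, P a) -> exists m, is_max_on P F m.
Proof.
move=> [a0 Pa0].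
have [a /boolp.asboolP Pa a_max] :=
  @arg_maxP _ _ _ a0 (fun a => boolp.asbool (P a)) F
    (introT (boolp.asboolP _) Pa0).
exists (F a); split; first by exists a.
by move=> b /boolp.asboolP; exact: a_max.
Qed.

Section Ratio.
Context {R : realType} {V : finType} {k : nat}.
Variables (f g : {ffun 'I_k -> {set V}} -> R).
Hypotheses (V_gt0 : (0 < #|V|)%N) (k_gt0 : (0 < k)%N).
Hypothesis g_gt0 : forall A, 0 < g A.

(** The ratio is a weighted mean, with weights proportional to the products of
    increments times the values of g, of ratios f(A) / g(A) over chains. *)
Lemma pm_ext_ratio_le x m : comonotonic_family x ->
    (forall A, nonempty_chain A -> f A / g A <= m) ->
  pm_ext f x / pm_ext g x <= m.
Proof.
move=> [x_pos /comonotonic_sorts[p xp]] fg_le_m.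
rewrite ler_pdivrMr ?pm_ext_gt0 // !(pm_ext_sorts _ _ (fun=> p) xp).
apply: multilinear_form_le => [s j|i].
  by apply: increment_ge0 => // v; case: (x_pos s).
rewrite -ler_pdivrMr //; apply/fg_le_m/tail_sets_nonempty_chain.
by have /andP[] := xp (Ordinal k_gt0).
Qed.

(** For each enumeration p the ratio, as a function of the increments along p,
    attains its maximum at some t p; the best of the finitely many t p is the
    increment vector of the maximiser c. *)
Lemma pm_ext_diag_ratio_max :
  exists2 c : {ffun V -> R}, nonneg_nonzero c &
    forall x, nonneg_nonzero x ->
      pm_ext f (diag x) / pm_ext g (diag x)
      <= pm_ext f (diag c) / pm_ext g (diag c).
Proof.
pose coef (h : {ffun 'I_k -> {set V}} -> R) (p : #|V|.-tuple V)
  (i : {ffun 'I_k -> 'I_#|V|}) := h [ffun s => tail_set p (i s)].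
pose form h p (t : 'I_#|V| -> R) := multilinear_form (coef h p) (fun=> t).
have formE h x (p : #|V|.-tuple V) : sorts x p ->
    pm_ext h (diag x) = form h p (fun j => increment x j).
  move=> xp; rewrite (@pm_ext_sorts _ _ _ _ _ (fun=> tval p)) => [|s].
    congr multilinear_form; apply/boolp.funext => s; apply/boolp.funext => j.
    by rewrite ffunE.
  by rewrite ffunE.
have /fin_all_exists[t t_max] (p : #|V|.-tuple V) :=
  Simplex.multilinear_form_ratio_max _ _ _ (coef f p) (coef g p) V_gt0
    (fun i => g_gt0 [ffun s => tail_set p (i s)]).
have [p p_enum p_max] := @arg_maxP _ _ _ (enum_tuple V)
  (fun p : #|V|.-tuple V => perm_eq p (enum V))
  (fun p : #|V|.-tuple V => form f p (t p) / form g p (t p)) (perm_refl _).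
have [t_ge0 [j tj_gt0] _] := t_max p.
have [c [cp c_ge0] c_incr] := sorts_with_increments p (t p) p_enum t_ge0.
exists c.
  split=> //; apply: contraTneq tj_gt0 => c0.
  by rewrite -c_incr -leNgt /increment c0 !ordstat0 subrr.
move=> x x_pos.
have c_form h : pm_ext h (diag c) = form h p (t p).
  rewrite (formE _ _ _ cp); congr multilinear_form.
  by apply/boolp.funext => s; apply/boolp.funext.
rewrite !c_form.
have [q xq] : exists q : #|V|.-tuple V, sorts x q.
  have xq := sorts_sort x; have /andP[q_enum _] := xq.
  have size_q : size (sort (relpre x <=%R) (enum V)) == #|V|.
    by rewrite (perm_size q_enum) cardE.
  by exists (Tuple size_q).
have /andP[q_enum _] := xq; rewrite !(formE _ _ _ xq).
apply: le_trans (p_max q q_enum); have [_ _ ] := t_max q; apply.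
  by move=> i; apply: increment_ge0 => //; case: x_pos.
exact: increment_gt0.
Qed.

Lemma maxima_compare :
  exists m1 m2 m3 m4 : R,
    [/\ is_max_on (fun A : {set V} => A != set0 : Prop)
          (fun A => f (diag A) / g (diag A)) m1,
        is_max_on (@nonneg_nonzero R V)
          (fun x => pm_ext f (diag x) / pm_ext g (diag x)) m2,
        is_max_on (@nonempty_chain V k) (fun A => f A / g A) m3,
        is_max_on (@comonotonic_family R V k)
          (fun x => pm_ext f x / pm_ext g x) m4
      & [/\ m1 <= m2, m2 <= m3 & m3 = m4]].
Proof.
have VT : [set: V] != set0 by rewrite -card_gt0 cardsT.
have [m1 m1_max] : exists m1,
    is_max_on (fun A : {set V} => A != set0 : Prop)
      (fun A => f (diag A) / g (diag A)) m1.
  by apply: fin_max_exists; exists [set: V].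
have [m3 m3_max] : exists m3,
    is_max_on (@nonempty_chain V k) (fun A => f A / g A) m3.
  apply: fin_max_exists; exists (diag [set: V]).
  split=> [s|]; first by rewrite ffunE.
  by apply/is_chainP => s t; rewrite !ffunE subxx.
have [c c_pos c_max] := pm_ext_diag_ratio_max.
have m4_max : is_max_on (@comonotonic_family R V k)
    (fun x => pm_ext f x / pm_ext g x) m3.
  case: m3_max => [[A A_chain <-] A_max]; split; last first.
    by move=> x x_com; exact: pm_ext_ratio_le.
  exists [ffun s => indicator (A s)]; first exact: indicator_comonotonic_family.
  by case: A_chain => A_neq0 _; rewrite !pm_ext_indicator.
exists m1, (pm_ext f (diag c) / pm_ext g (diag c)), m3, m3; split=> //.
  by split=> //; exists c.
split=> //.
  case: m1_max => [[A A_neq0 <-] _].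
  have := c_max _ (indicator_nonneg_nonzero A A_neq0); apply: le_trans.
  have diag_indicator : diag (indicator A)
      = [ffun s => indicator (diag A s)] :> {ffun 'I_k -> {ffun V -> R}}.
    by apply/ffunP => s; rewrite !ffunE.
  by rewrite diag_indicator !pm_ext_indicator // => s; rewrite ffunE.
by case: m4_max => _; apply; exact: diag_comonotonic_family.
Qed.

End Ratio.

Lemma is_min_on_opp (R : realType) (T : Type) (P : T -> Prop) (F G : T -> R) m :
  (forall a, G a = - F a) -> is_max_on P G m -> is_min_on P F (- m).
Proof.
move=> GF [[a Pa <-] a_max]; split; first by exists a => //; rewrite GF opprK.
by move=> b /a_max; rewrite !GF opprK lerN2.
Qed.

Theorem theorem1p4 (R : realType) (V : finType) (k : nat)
    (f g : {ffun 'I_k -> {set V}} -> R)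
    (V_gt0 : (0 < #|V|)%N) (k_gt0 : (0 < k)%N)
    (g_gt0 : forall A : {ffun 'I_k -> {set V}}, 0 < g A) :
  (exists m1 m2 m3 m4 : R,
    [/\ is_max_on (fun A : {set V} => A != set0 : Prop)
          (fun A => f (diag A) / g (diag A)) m1,
        is_max_on (@nonneg_nonzero R V)
          (fun x => pm_ext f (diag x) / pm_ext g (diag x)) m2,
        is_max_on (@nonempty_chain V k) (fun A => f A / g A) m3,
        is_max_on (@comonotonic_family R V k)
          (fun x => pm_ext f x / pm_ext g x) m4
      & [/\ m1 <= m2, m2 <= m3 & m3 = m4]])
  /\
  (exists m1 m2 m3 m4 : R,
    [/\ is_min_on (fun A : {set V} => A != set0 : Prop)
          (fun A => f (diag A) / g (diag A)) m1,
        is_min_on (@nonneg_nonzero R V)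
          (fun x => pm_ext f (diag x) / pm_ext g (diag x)) m2,
        is_min_on (@nonempty_chain V k) (fun A => f A / g A) m3,
        is_min_on (@comonotonic_family R V k)
          (fun x => pm_ext f x / pm_ext g x) m4
      & [/\ m1 >= m2, m2 >= m3 & m3 = m4]]).
Proof.
split; first exact: maxima_compare.
have [m1 [m2 [m3 [m4 [m1P m2P m3P m4P [le12 le23 eq34]]]]]] :=
  maxima_compare (fun A => - f A) g V_gt0 k_gt0 g_gt0.
exists (- m1), (- m2), (- m3), (- m4).
split; last by split; rewrite ?lerN2 // eq34.
- by apply: (is_min_on_opp _ _ _ _ _ _ _ m1P) => A; rewrite mulNr.
- by apply: (is_min_on_opp _ _ _ _ _ _ _ m2P) => x; rewrite pm_extN mulNr.
- by apply: (is_min_on_opp _ _ _ _ _ _ _ m3P) => A; rewrite mulNr.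
- by apply: (is_min_on_opp _ _ _ _ _ _ _ m4P) => x; rewrite pm_extN mulNr.
Qed.
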